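(* Fix an integer $n\geq 2$. For integers $a,s\in\mathbb{Z}$ write $\xi_{N,a}(s)=\exp\left(\frac{s\pi\sqrt{-1}}{N+a}\right)$. The following two assertions (A) and (B), in which $s\in\mathbb{Z}$, are equivalent. (A): (i) If $a\in\mathbb{Z}\setminus\{1,2,\dots,n-1\}$, then for any knot $\mathcal{K}$, $$2\pi s\lim_{N\rightarrow\infty}\frac{\log J_{N}^{SU(n)}(\mathcal{K};\xi_{N,a}(s))}{N+1}=0.$$ (ii) If $a\in\{1,2,\dots,n-1\}$, then for any hyperbolic knot $\mathcal{K}$, $$2\pi s\lim_{N\rightarrow\infty}\frac{\log J_{N}^{SU(n)}(\mathcal{K};\xi_{N,a}(s))}{N+1}=Vol(S^3\setminus\mathcal{K})+\sqrt{-1}\,CS(S^3\setminus\mathcal{K}).$$ (B): (i) If $a\in\mathbb{Z}\setminus\{1,2,\dots,n-1\}$, then for any knot $\mathcal{K}$, $$2\pi s\lim_{N\rightarrow\infty}\frac{\log J_{N}^{SU(N+a+n)}(\mathcal{K};\xi_{N,a}(s))}{N+1}=0.$$ (ii) If $a\in\{1,2,\dots,n-1\}$, then for any hyperbolic knot $\mathcal{K}$, $$2\pi s\lim_{N\rightarrow\infty}\frac{\log J_{N}^{SU(N+a+n)}(\mathcal{K};\xi_{N,a}(s))}{N+1}=Vol(S^3\setminus\mathcal{K})+\sqrt{-1}\,CS(S^3\setminus\mathcal{K}).$$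
   Context: $Vol$ and $CS$ are the hyperbolic volume and Chern–Simons invariant of the knot complement in $S^3$. Limits are along integers $N\to\infty$ (so $N+a$ is eventually at least $2$). The convention for the logarithm and for the normalization/indeterminacy of $CS$ is the same in (A) and (B). Definition of $J_N^{SU(n)}$. The unreduced framed HOMFLYPT polynomial $\mathcal{H}(D;q,t)$ of an oriented link diagram is the regular isotopy invariant with $\mathcal{H}(D_+)-\mathcal{H}(D_-)=(q-q^{-1})\mathcal{H}(D_0)$ on Conway triples, a positive (negative) kink multiplying by $t$ ($t^{-1}$), and $\mathcal{H}(U)=\frac{t-t^{-1}}{q-q^{-1}}$ for the zero-writhe unknot diagram (same factor for a disjoint circle). In the Hecke algebra on $N$ strands with positive crossings $\sigma_i$, $\sigma_i-\sigma_i^{-1}=q-q^{-1}$, let $E_{(N)}$ be the nonzero idempotent with $\sigma_iE_{(N)}=E_{(N)}\sigma_i=qE_{(N)}$ for all $i$, and $Q_{(N)}$ its closure in the annulus. For a knot $\mathcal{K}$ with a diagram of writhe $w(\mathcal{K})$, $W_{(N)}(\mathcal{K};q,t)=q^{-N(N-1)w(\mathcal{K})}t^{-Nw(\mathcal{K})}\mathcal{H}(\mathcal{K}\star Q_{(N)};q,t)$, where $\mathcal{K}\star Q_{(N)}$ is the blackboard-framed satellite decorated by $Q_{(N)}$. With $S_{(N)}(q,t)=W_{(N)}(\text{unknot};q,t)$, the quotient $P_N=W_{(N)}/S_{(N)}$ is a Laurent polynomial in $q,t$ with integer coefficients, and $J_N^{SU(n)}(\mathcal{K};q)=P_N(\mathcal{K};q,q^n)$.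 *)

(* Defs.v *)
From HB Require Import structures.
From mathcomp Require Import all_boot all_order all_algebra.
From mathcomp Require Import complex.
From mathcomp Require Import all_classical all_reals all_analysis.

Set Implicit Arguments.
Unset Strict Implicit.
Unset Printing Implicit Defensive.
Import Order.TTheory GRing.Theory Num.Theory.
Import numFieldNormedType.Exports.

Local Open Scope classical_set_scope.
Local Open Scope ring_scope.

(* Oriented link diagrams in the plane are in Morse position and are read from
   bottom to top as words in the following pieces; the strands met by a
   horizontal line are numbered from 0, from left to right.
   - [Cup i b]: a local minimum creating the strands i and i+1; b = true means
     that strand i is oriented upwards (and strand i+1 downwards).
   - [Cap i]: a local maximum joining the strands i and i+1.
   - [Cross i o]: the strands i and i+1 cross; o = true means that the strand
     going from bottom left to top right is the overcrossing one. *)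
Inductive piece := Cup of nat & bool | Cap of nat | Cross of nat & bool.

Definition pos (p : piece) : nat :=
  match p with Cup i _ => i | Cap i => i | Cross i _ => i end.

Definition n_in (p : piece) : nat := if p is Cup _ _ then 0 else 2.

Definition n_out (p : piece) : nat := if p is Cap _ then 0 else 2.

Definition move_to (j : nat) (p : piece) : piece :=
  match p with Cup _ b => Cup j b | Cap _ => Cap j | Cross _ o => Cross j o end.

(* The state [s] lists the orientations (true = upwards) of the strands. *)
Definition step (s : seq bool) (p : piece) : option (seq bool) :=
  match p with
  | Cup i b => if (i <= size s)%N
      then Some (take i s ++ [:: b; ~~ b] ++ drop i s) else None
  | Cap i => if (i.+1 < size s)%N && (nth true s i != nth true s i.+1)
      then Some (take i s ++ drop i.+2 s) else None
  | Cross i _ => if (i.+1 < size s)%N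
      then Some (take i s ++ [:: nth true s i.+1; nth true s i] ++ drop i.+2 s)
      else None
  end.

Fixpoint run (s : seq bool) (w : seq piece) : option (seq bool) :=
  if w is p :: w' then obind (run^~ w') (step s p) else Some s.

Definition link_diagram (w : seq piece) : bool := run [::] w == Some [::].

(* Reversing one of the two strands changes the sign of a crossing. *)
Definition crossing_sign (s : seq bool) (p : piece) : int :=
  if p is Cross i o then
    if o == (nth true s i == nth true s i.+1) then 1 else -1
  else 0.

Fixpoint writhe_from (s : seq bool) (w : seq piece) : int :=
  if w is p :: w' then
    crossing_sign s p + writhe_from (odflt [::] (step s p)) w'
  else 0.

Definition writhe (w : seq piece) : int := writhe_from [::] w.

(* The state [s] labels the strands so that two of them have the same label
   exactly when they are the two ends of an arc of the part already read;
   labels >= [fresh] are unused. *)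
Fixpoint ncomp_from (fresh : nat) (s : seq nat) (w : seq piece) : nat :=
  match w with
  | [::] => 0
  | Cup i _ :: w' =>
      ncomp_from fresh.+1 (take i s ++ [:: fresh; fresh] ++ drop i s) w'
  | Cap i :: w' =>
      let a := nth 0%N s i in
      let b := nth 0%N s i.+1 in
      let s' := take i s ++ drop i.+2 s in
      if a == b then (ncomp_from fresh s' w').+1
      else ncomp_from fresh [seq if x == b then a else x | x <- s'] w'
  | Cross i _ :: w' =>
      ncomp_from fresh
        (take i s ++ [:: nth 0%N s i.+1; nth 0%N s i] ++ drop i.+2 s) w'
  end.

Definition ncomp (w : seq piece) : nat := ncomp_from 0 [::] w.

Definition knot_diagram (w : seq piece) : bool :=
  link_diagram w && (ncomp w == 1%N).

(* Regular isotopy of diagrams in Morse position: isotopies of the plane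
   ([rm_far], [rm_zigzagl], [rm_zigzagr]; and, for a strand passing a maximum
   or a minimum, [rm_cap], [rm_cup]) and the Reidemeister moves II and III.
   In [rm_R3] the bits a, b, c tell which strand is on top for the pairs (1,2),
   (1,3), (2,3) of strands; the side condition excludes the two cyclic
   configurations. *)
Inductive regular_move : seq piece -> seq piece -> Prop :=
| rm_far p r : (pos p + n_in p <= pos r)%N ->
    regular_move [:: r; p] [:: p; move_to (pos r - n_in p + n_out p)%N r]
| rm_zigzagl i b : regular_move [:: Cup i b; Cap i.+1] [::]
| rm_zigzagr i b : regular_move [:: Cup i.+1 b; Cap i] [::]
| rm_cap i o :
    regular_move [:: Cross i o; Cap i.+1] [:: Cross i.+1 (~~ o); Cap i]
| rm_cup i b o :
    regular_move [:: Cup i.+1 b; Cross i o] [:: Cup i b; Cross i.+1 (~~ o)]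
| rm_R2 i o : regular_move [:: Cross i o; Cross i (~~ o)] [::]
| rm_R3 i a b c : (b == a) || (b == c) ->
    regular_move [:: Cross i a; Cross i.+1 b; Cross i c]
                 [:: Cross i.+1 c; Cross i b; Cross i.+1 a].

(* Oriented smoothing of a crossing of the strands i and i+1, whose
   orientations below the crossing are d and d'. *)
Definition smoothing (i : nat) (d d' : bool) : seq piece :=
  if d == d' then [::] else [:: Cap i; Cup i d'].

(* The two Morse forms of a kink; in both of them the strands at the crossing
   are parallel, so that the sign of the crossing is given by o. *)
Definition kink (left : bool) (i : nat) (b o : bool) : seq piece :=
  if left then [:: Cup i b; Cross i.+1 o; Cap i]
  else [:: Cup i.+1 b; Cross i o; Cap i.+1].

Definition circle (i : nat) (b : bool) : seq piece := [:: Cup i b; Cap i].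

(* Q(q) and Q(q)(t) *)
Notation Kq := {fraction {poly int}}.
Notation Kqt := {fraction {poly Kq}}.

Definition q1 : Kq := tofrac ('X : {poly int}).
Definition Kq_Kqt (x : Kq) : Kqt := tofrac (x%:P).
Definition q : Kqt := Kq_Kqt q1.
Definition t : Kqt := tofrac ('X : {poly Kq}).

Record framed_homflypt_axioms (H : seq piece -> Kqt) : Prop := {
  (* convention: words that are not diagrams get the value 0 *)
  homflypt_junk : forall w, ~~ link_diagram w -> H w = 0;
  homflypt_isotopy : forall u l r v, regular_move l r ->
    link_diagram (u ++ l ++ v) -> link_diagram (u ++ r ++ v) ->
    H (u ++ l ++ v) = H (u ++ r ++ v);
  homflypt_skein : forall u v s i, run [::] u = Some s ->
    link_diagram (u ++ Cross i true :: v) ->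
    let d := nth true s i in let d' := nth true s i.+1 in
    H (u ++ Cross i (d == d') :: v) - H (u ++ Cross i (d != d') :: v)
      = (q - q^-1) * H (u ++ smoothing i d d' ++ v);
  homflypt_kink : forall u v left i b o,
    link_diagram (u ++ kink left i b o ++ v) -> link_diagram (u ++ v) ->
    H (u ++ kink left i b o ++ v) = (if o then t else t^-1) * H (u ++ v);
  homflypt_unknot : forall b, H (circle 0 b) = (t - t^-1) / (q - q^-1);
  homflypt_circle : forall u v i b,
    link_diagram (u ++ circle i b ++ v) -> link_diagram (u ++ v) ->
    H (u ++ circle i b ++ v) = (t - t^-1) / (q - q^-1) * H (u ++ v)
}.

(* "the" invariant with the above properties (definite description) *)
Definition homflypt : seq piece -> Kqt :=
  xget (fun=> 0) [set H | unique framed_homflypt_axioms H].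

(* The Hecke algebra on N strands over Q(q) is handled through its
   presentation: an element is a formal combination of words in the
   sigma_i^{+-1} (i < N-1; the bit true stands for the exponent +1), and two of
   them are equal in it iff they have the same value for all families of
   elements of a Q(q)-algebra satisfying the defining relations. The quadratic
   relation is sigma_i^{-1} = sigma_i - (q - q^{-1}). *)
Definition braid_word (N : nat) := seq ('I_N.-1 * bool).
Definition hecke_comb (N : nat) := seq (Kq * braid_word N).

Record hecke_family (N : nat) (A : algType Kq) (g : 'I_N.-1 -> A) : Prop := {
  hecke_quad : forall i, g i * (g i - (q1 - q1^-1)%:A) = 1;
  hecke_braid : forall i j : 'I_N.-1, j = i.+1 :> nat ->
    g i * g j * g i = g j * g i * g j;
  hecke_comm : forall i j : 'I_N.-1, (i.+1 < j)%N -> g i * g j = g j * g i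
}.

Definition hecke_eval (N : nat) (A : algType Kq) (g : 'I_N.-1 -> A)
    (e : hecke_comb N) : A :=
  \sum_(x <- e) x.1 *:
    \prod_(l <- x.2) (if l.2 then g l.1 else g l.1 - (q1 - q1^-1)%:A).

Definition row_idempotent (N : nat) (e : hecke_comb N) : Prop :=
  (forall (A : algType Kq) (g : 'I_N.-1 -> A), hecke_family g ->
     hecke_eval g e * hecke_eval g e = hecke_eval g e /\
     forall i, g i * hecke_eval g e = q1 *: hecke_eval g e /\
               hecke_eval g e * g i = q1 *: hecke_eval g e) /\
  (exists (A : algType Kq) (g : 'I_N.-1 -> A),
     hecke_family g /\ hecke_eval g e <> 0).

Definition E_row (N : nat) : hecke_comb N :=
  xget [::] [set e | row_idempotent e].

Definition parallel_piece (N : nat) (p : piece) : seq piece :=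
  match p with
  | Cup i b => [seq Cup (N * i + k)%N b | k <- iota 0 N]
  | Cap i => [seq Cap (N * i + k)%N | k <- rev (iota 0 N)]
  | Cross i o =>
      [seq Cross (N * i + a + b)%N o | a <- rev (iota 0 N), b <- iota 0 N]
  end.

Definition braid_at (N off : nat) (x : braid_word N) : seq piece :=
  [seq Cross (off + val l.1)%N l.2 | l <- x].

(* N parallel copies of the diagram w, with the braid x inserted just above the
   first cup, across the N copies of the leg of this cup that is oriented
   upwards. *)
Definition satellite (N : nat) (w : seq piece) (x : braid_word N) : seq piece :=
  if w is Cup i b :: w' then
    parallel_piece N (Cup i b)
      ++ braid_at (N * (if b then i else i.+1))%N x
      ++ flatten [seq parallel_piece N p | p <- w']
  else [::].

Definition homflypt_row (N : nat) (w : seq piece) : Kqt :=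
  \sum_(x <- E_row N) Kq_Kqt x.1 * homflypt (satellite w x.2).

Definition W_row (N : nat) (w : seq piece) : Kqt :=
  q ^ (- ((N * N.-1)%:Z * writhe w)) * t ^ (- (N%:Z * writhe w))
    * homflypt_row N w.

Definition S_row (N : nat) : Kqt := W_row N (circle 0 true).

(* (P, i, j) stands for the Laurent polynomial q^{-i} t^{-j} P, where the
   coefficients of P, as a polynomial in t, are polynomials in q *)
Definition laurent := ({poly {poly int}} * nat * nat)%type.

Definition laurent_frac (L : laurent) : Kqt :=
  let: (P, i, j) := L in
  tofrac (map_poly (@tofrac {poly int}) P) * q ^- i * t ^- j.

Definition laurent_eval (C : fieldType) (L : laurent) (q0 t0 : C) : C :=
  let: (P, i, j) := L in
  (map_poly (fun c : {poly int} => (map_poly intr c).[q0]) P).[t0]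
    * q0 ^- i * t0 ^- j.

Definition P_row (N : nat) (w : seq piece) : laurent :=
  xget (0, 0%N, 0%N) [set L | laurent_frac L = W_row N w / S_row N].

(* J_N^{SU(m)} of the knot with diagram w, at q = q0 *)
Definition J_SU (C : fieldType) (m : int) (N : nat) (w : seq piece) (q0 : C)
  : C := laurent_eval (P_row N w) q0 (q0 ^ m).

Local Open Scope complex_scope.

Definition R3 (R : realType) := (R * R * R)%type.
Definition S3 (R : realType) := one_point_compactification (R * R * R)%type.

Definition point {R : realType} (x y z : R) : R3 R := (x, y, z).

Definition segment {R : realType} (x y : R3 R) : set (R3 R) :=
  [set p | exists2 l : R, 0 <= l <= 1 &
     p = point (x.1.1 + l * (y.1.1 - x.1.1)) (x.1.2 + l * (y.1.2 - x.1.2))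
               (x.2 + l * (y.2 - x.2))].

Definition arc {R : realType} (x y z : R3 R) : set (R3 R) :=
  segment x y `|` segment y z.

(* The part of the link between the heights k and k+1 that corresponds to a
   piece met by n strands at height k. At height k, strand j is at (j, k, 0).
   The diagram is the projection to the first two coordinates, the third
   coordinate pointing to the viewer. *)
Definition piece_curve {R : realType} (k n : nat) (p : piece) : set (R3 R) :=
  let bot (j : nat) : R3 R := point j%:R k%:R 0 in
  let top (j : nat) : R3 R := point j%:R k.+1%:R 0 in
  let mid (i : nat) (h : R) : R3 R := point (i%:R + 2^-1) (k%:R + 2^-1) h in
  match p with
  | Cup i _ =>
      arc (top i) (mid i 0) (top i.+1)
      `|` \bigcup_(j in [set j | (j < n)%N])
            segment (bot j) (top (if (j < i)%N then j else j.+2))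
  | Cap i =>
      arc (bot i) (mid i 0) (bot i.+1)
      `|` \bigcup_(j in [set j | (j < n)%N /\ j <> i /\ j <> i.+1])
            segment (bot j) (top (if (j < i)%N then j else (j - 2)%N))
  | Cross i o =>
      arc (bot i) (mid i (if o then 1 else 0)) (top i.+1)
      `|` arc (bot i.+1) (mid i (if o then 0 else 1)) (top i)
      `|` \bigcup_(j in [set j | (j < n)%N /\ j <> i /\ j <> i.+1])
            segment (bot j) (top j)
  end.

Fixpoint link_from {R : realType} (k : nat) (s : seq bool) (w : seq piece)
    : set (R3 R) :=
  if w is p :: w' then
    piece_curve k (size s) p `|` link_from k.+1 (odflt [::] (step s p)) w'
  else set0.

(* S^3 minus the polygonal link of R^3 with diagram w *)
Definition link_complement {R : realType} (w : seq piece) : set (S3 R) :=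
  ~` (Some @` link_from 0 [::] w).

(* The upper half-space model of hyperbolic 3-space. *)
Definition H3 {R : realType} : set (R3 R) := [set x | 0 < x.2].

Definition cosh_hdist {R : realType} (x y : R3 R) : R :=
  1 + ((x.1.1 - y.1.1) ^+ 2 + (x.1.2 - y.1.2) ^+ 2 + (x.2 - y.2) ^+ 2)
      / (2 * x.2 * y.2).

Definition hyp_isometry {R : realType} (g : R3 R -> R3 R) : Prop :=
  g @` H3 = H3 /\
  {in H3 &, forall x y, cosh_hdist (g x) (g y) = cosh_hdist x y}.

(* A complete hyperbolic structure on an open subset X of S^3: a covering of X
   by H^3, inducing a homeomorphism of X with the quotient of H^3 by a group of
   isometries (the deck transformations). *)
Record hyp_cover {R : realType} (X : set (S3 R)) (f : R3 R -> S3 R) : Prop := {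
  hyp_cover_cont : {within H3, continuous f};
  hyp_cover_open : forall U : set (R3 R), open U -> U `<=` H3 -> open (f @` U);
  hyp_cover_surj : f @` H3 = X;
  hyp_cover_inj : forall x, H3 x -> exists2 U, nbhs x U & {in U &, injective f};
  hyp_cover_deck : forall x y, H3 x -> H3 y -> f x = f y ->
    exists g, [/\ hyp_isometry g, {in H3, f \o g =1 f} & g x = y]
}.

(* The volume is computed on a Borel fundamental domain. *)
Definition has_hyp_volume {R : realType} (X : set (S3 R)) (v : R) : Prop :=
  exists (f : R3 R -> S3 R) (D : set (R * R * R)),
    [/\ hyp_cover X f, measurable D /\ D `<=` H3, {in D &, injective f},
        f @` D = X &
        (\int[(lebesgue_measure \x lebesgue_measure) \x lebesgue_measure]_(x in D)
           ((x.2 ^- 3)%:E) = v%:E)%E].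

Definition hyperbolic_link (R : realType) (w : seq piece) : Prop :=
  exists v : R, has_hyp_volume (link_complement w) v.

Definition Vol {R : realType} (X : set (S3 R)) : R :=
  xget 0 [set v | has_hyp_volume X v].

Definition cexp {R : realType} (z : R[i]) : R[i] :=
  let: x +i* y := z in (expR x)%:C * (cos y +i* sin y).

Definition log_branch {R : realType} (L : R[i] -> R[i]) : Prop :=
  forall z, z != 0 -> cexp (L z) = z.

Definition xi (R : realType) (s a : int) (N : nat) : R[i] :=
  cexp ((s%:~R * pi / (N%:Z + a)%:~R)%:C * 'i).

(* lim_N (log u_N) / (N + 1) = l, where L N is the branch of the logarithm used
   for u_N; the logarithms must be defined for all large N *)
Definition log_growth {R : realType} (L : nat -> R[i] -> R[i]) (u : nat -> R[i])
    (l : R[i]) : Prop :=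
  (\forall N \near \oo, u N != 0) /\
  (fun N => L N (u N) / N.+1%:R : R[i]^o) @ \oo --> (l : R[i]^o).

(* Main.v *)
(* At [q = xi_{N,a}(s)] one has [q^(N+a) = (-1)^s], so the two families of
   evaluation points [t = q^n] and [t = q^(N+a+n)] agree up to sign, and it
   suffices that [P_N] is even in [t] for a knot. By uniqueness of the framed
   HOMFLYPT polynomial [H], replacing [t] by [-t] multiplies [H D] by
   [(-1)^rot D], where [rot] is the rotation number: the twisted function
   satisfies the same axioms. The rotation number of the satellite is
   [N * rot K] for every braid, and [rot K + writhe K + 1] is even for a knot
   (Whitney), so the framing factor [t^(-N * writhe K)] leaves the sign
   [(-1)^N], which the unknot contributes as well. *)
Require Import Defs.
From HB Require Import structures.
From mathcomp Require Import all_boot all_order all_algebra.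
From mathcomp Require Import complex.
From mathcomp Require Import all_classical all_reals all_analysis.
From mathcomp Require Import zify ring.
Import Order.TTheory GRing.Theory Num.Theory.
Import numFieldNormedType.Exports.
Local Open Scope classical_set_scope.
Local Open Scope ring_scope.
Local Open Scope complex_scope.

Set Implicit Arguments.
Unset Strict Implicit.

(** * The automorphism t |-> - t of the field of fractions *)

Lemma fractionE (A : idomainType) (x : {fraction A}) :
  exists2 nd : A * A, nd.2 != 0 & x = tofrac nd.1 / tofrac nd.2.
Proof.
elim/quotW: x => r; exists (frac r); first exact: denom_ratioP.
rewrite !piE; apply/eqmodP => /=.
rewrite FracField.equivfE /FracField.mulf /FracField.invf /=.
have d1 : 1 * (frac r).2 != 0 by rewrite mul1r denom_ratioP.
rewrite !numden_Ratio ?oner_neq0 ?denom_ratioP //.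
by rewrite !mulr1 mul1r mulrC.
Qed.

(** A numerator and a denominator are picked by choice; [fractionE] guarantees that some exist, and
    [frac_ext_div] that for an injective morphism [f] the value does not depend on them. *)
Definition frac_ext (A : idomainType) (F : fieldType) (f : A -> F)
    (x : {fraction A}) : F :=
  let nd := xget (0, 1) [set nd : A * A |
                  nd.2 != 0 /\ x = tofrac nd.1 / tofrac nd.2] in
  f nd.1 / f nd.2.

Section FracExt.
Variables (A : idomainType) (F : fieldType) (f : {rmorphism A -> F}).
Hypothesis f_inj : injective f.

Let f_neq0 (x : A) : x != 0 -> f x != 0.
Proof. by rewrite -(inj_eq f_inj) rmorph0. Qed.

Lemma frac_ext_div (n d : A) : d != 0 ->
  frac_ext f (tofrac n / tofrac d) = f n / f d.
Proof.
move=> d0; rewrite /frac_ext.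
case: xgetP => [[n' d'] _ /= [d'0]|/(_ (n, d))]; last first.
  by move/not_andP; case=> // /negP; rewrite d0.
move/eqP; rewrite eqr_div ?tofrac_eq0 // -!tofracM tofrac_eq => /eqP e.
by apply/eqP; rewrite eqr_div ?f_neq0 // -!rmorphM e.
Qed.

Lemma frac_ext_tofrac (x : A) : frac_ext f (tofrac x) = f x.
Proof.
rewrite -[tofrac x]divr1 -[1](tofrac1 A) frac_ext_div ?oner_neq0 //.
by rewrite rmorph1 divr1.
Qed.

Lemma frac_ext_zmod_morphism : zmod_morphism (frac_ext f).
Proof.
move=> x y; have [[n d] /= d0 ->] := fractionE x.
have [[n' d'] /= d'0 ->] := fractionE y.
rewrite -mulNr addf_div ?tofrac_eq0 // -tofracN -!tofracM -tofracD.
rewrite !frac_ext_div ?mulf_neq0 // rmorphD !rmorphM rmorphN.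
by rewrite -mulNr addf_div ?f_neq0.
Qed.

Lemma frac_ext_monoid_morphism : monoid_morphism (frac_ext f).
Proof.
split; first by rewrite -(tofrac1 A) frac_ext_tofrac rmorph1.
move=> x y; have [[n d] /= d0 ->] := fractionE x.
have [[n' d'] /= d'0 ->] := fractionE y.
rewrite mulf_div -!tofracM !frac_ext_div ?mulf_neq0 // !rmorphM.
by rewrite mulf_div.
Qed.
End FracExt.

Lemma comp_poly_oppXK (A : comNzRingType) (p : {poly A}) :
  (p \Po - 'X) \Po - 'X = p.
Proof. by rewrite -comp_polyA rmorphN /= comp_polyX opprK comp_polyXr. Qed.

Section NegVariable.
Variable A : idomainType.
Implicit Types p : {poly A}.

Definition neg_poly p : {fraction {poly A}} := tofrac (p \Po - 'X).

Lemma neg_poly_zmod_morphism : zmod_morphism neg_poly.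
Proof. by move=> p p'; rewrite /neg_poly rmorphB /= tofracB. Qed.

Lemma neg_poly_monoid_morphism : monoid_morphism neg_poly.
Proof.
by split=> [|p p']; rewrite /neg_poly ?rmorph1 ?tofrac1 // rmorphM /= tofracM.
Qed.

HB.instance Definition _ :=
  GRing.isZmodMorphism.Build {poly A} {fraction {poly A}} neg_poly
    neg_poly_zmod_morphism.
HB.instance Definition _ :=
  GRing.isMonoidMorphism.Build {poly A} {fraction {poly A}} neg_poly
    neg_poly_monoid_morphism.

Lemma neg_poly_inj : injective neg_poly.
Proof.
move=> p p' /eqP; rewrite tofrac_eq => /eqP /(congr1 (comp_poly (- 'X))).
by rewrite !comp_poly_oppXK.
Qed.

Definition neg_t : {fraction {poly A}} -> {fraction {poly A}} :=
  frac_ext neg_poly.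

HB.instance Definition _ := GRing.isZmodMorphism.Build _ _ neg_t
  (frac_ext_zmod_morphism neg_poly_inj).
HB.instance Definition _ := GRing.isMonoidMorphism.Build _ _ neg_t
  (frac_ext_monoid_morphism neg_poly_inj).

Lemma neg_t_poly p : neg_t (tofrac p) = tofrac (p \Po - 'X).
Proof. exact: (frac_ext_tofrac neg_poly_inj). Qed.

(* Rewriting with the generic morphism lemmas diverges in the iterated fraction
   field [Kqt], hence these instances over an abstract domain. *)
Lemma neg_t0 : neg_t 0 = 0.
Proof. exact: raddf0. Qed.

Lemma neg_tB : {morph neg_t : x y / x - y}.
Proof. exact: raddfB. Qed.

Lemma neg_tM : {morph neg_t : x y / x * y}.
Proof. exact: rmorphM. Qed.

Lemma neg_t_sum (I : Type) (r : seq I) (G : I -> {fraction {poly A}}) :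
  neg_t (\sum_(i <- r) G i) = \sum_(i <- r) neg_t (G i).
Proof. exact: raddf_sum. Qed.

Lemma neg_tXz (x : {fraction {poly A}}) (z : int) : neg_t (x ^ z) = neg_t x ^ z.
Proof. exact: fmorphXz. Qed.

Lemma neg_tX (x : {fraction {poly A}}) (k : nat) :
  neg_t (x ^+ k) = neg_t x ^+ k.
Proof. exact: rmorphXn. Qed.

Lemma neg_tV : {morph neg_t : x / x^-1}.
Proof. exact: fmorphV. Qed.

End NegVariable.

Lemma neg_t_const (c : Kq) : neg_t (Kq_Kqt c) = Kq_Kqt c.
Proof. by rewrite neg_t_poly comp_polyC. Qed.

Lemma neg_t_q : neg_t q = q.
Proof. exact: neg_t_const. Qed.

Lemma neg_t_t : neg_t t = - t.
Proof. by rewrite neg_t_poly comp_polyX tofracN. Qed.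

(** * Rotation number modulo 2 *)

(* All the pieces commute with adding a strand on the left, so that statements
   about a piece at position i follow by induction from the case i = 0. *)
Definition shift (p : piece) : piece := move_to (pos p).+1 p.

Lemma step_shift (x : bool) (s : seq bool) (p : piece) :
  step (x :: s) (shift p) = omap (cons x) (step s p).
Proof. by case: p => [i b|i|i o] //=; rewrite ?ltnS; case: ifP. Qed.

Lemma run_cat (s : seq bool) (u v : seq piece) :
  run s (u ++ v) = obind (run^~ v) (run s u).
Proof. by elim: u s => //= p u IH s; case: step. Qed.

Lemma run_shift (x : bool) (s : seq bool) (w : seq piece) :
  run (x :: s) (map shift w) = omap (cons x) (run s w).
Proof.
elim: w s => //= p w IH s; rewrite step_shift.
by case: (step s p) => //= s'; rewrite IH.
Qed.

(* The arcs oriented from left to right at a local minimum and at a local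
   maximum; the difference of their numbers is the rotation number. *)
Definition turn (s : seq bool) (p : piece) : bool :=
  match p with
  | Cup _ b => ~~ b
  | Cap i => nth true s i
  | Cross _ _ => false
  end.

Fixpoint turning (s : seq bool) (w : seq piece) : bool :=
  if w is p :: w' then turn s p (+) turning (odflt [::] (step s p)) w'
  else false.

Lemma turn_shift (x : bool) (s : seq bool) (p : piece) :
  turn (x :: s) (shift p) = turn s p.
Proof. by case: p. Qed.

Lemma turning_shift (x : bool) (s : seq bool) (w : seq piece) : run s w ->
  turning (x :: s) (map shift w) = turning s w.
Proof.
elim: w s => //= p w IH s; rewrite turn_shift step_shift.
by case: (step s p) => //= s' /IH ->.
Qed.

Lemma turning_cat (s s' : seq bool) (u v : seq piece) : run s u = Some s' ->
  turning s (u ++ v) = turning s u (+) turning s' v.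
Proof.
elim: u s => [s [<-]|p u IH s] //=.
by case: (step s p) => //= s1 /IH ->; rewrite addbA.
Qed.

Lemma run_shiftP (x : bool) (s s' : seq bool) (w : seq piece) :
  run (x :: s) (map shift w) = Some s' ->
  exists2 s1, s' = x :: s1 & run s w = Some s1.
Proof. by rewrite run_shift; case: (run s w) => //= s1 [<-]; exists s1. Qed.

(** The local condition under which replacing [l] by [r] preserves the parity of the rotation
    number. Both runs are assumed to succeed because the isotopy axiom compares only words that are
    diagrams. *)
Definition same_effect (l r : seq piece) : Prop := forall s s1 s2,
  run s l = Some s1 -> run s r = Some s2 ->
  s1 = s2 /\ turning s l = turning s r.

(** On a nonempty state the leftmost strand is a spectator; the hypothesis on [l] disposes of the
    empty state. *)
Lemma same_effect_shift (l r : seq piece) : run [::] (map shift l) = None ->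
  same_effect l r -> same_effect (map shift l) (map shift r).
Proof.
move=> l0 lr [|x s] s1 s2; first by rewrite l0.
move=> /run_shiftP[s1' -> rl] /run_shiftP[s2' -> rr].
have [-> e] := lr _ _ _ rl rr.
by rewrite !turning_shift ?rl ?rr.
Qed.

Lemma pos_gt0_shift (p : piece) : (0 < pos p)%N -> exists p', p = shift p'.
Proof.
case: p => [[|i] b|[|i]|[|i] o] //= _.
- by exists (Cup i b).
- by exists (Cap i).
- by exists (Cross i o).
Qed.

Lemma pos_shift (p : piece) : pos (shift p) = (pos p).+1.
Proof. by case: p. Qed.

Lemma n_in_shift (p : piece) : n_in (shift p) = n_in p.
Proof. by case: p. Qed.

Lemma n_out_shift (p : piece) : n_out (shift p) = n_out p.
Proof. by case: p. Qed.

Lemma move_to_shift (j : nat) (p : piece) : move_to j (shift p) = move_to j p.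
Proof. by case: p. Qed.

Lemma shift_move_to (j : nat) (p : piece) :
  shift (move_to j p) = move_to j.+1 p.
Proof. by case: p. Qed.

Lemma move_to_pos (p : piece) : move_to (pos p) p = p.
Proof. by case: p. Qed.

(** The two pieces act on disjoint strands, so their turns add up in either order. Induction on the
    position of [p] shifts both pieces together down to position 0. *)
Lemma far_move_same_effect (p r : piece) : (pos p + n_in p <= pos r)%N ->
  same_effect [:: r; p] [:: p; move_to (pos r - n_in p + n_out p)%N r].
Proof.
elim: {p}(pos p) {-2}p (erefl (pos p)) r => [|i IH] p pi r.
  (* A cap or a crossing at position 0 occupies two strands, so [r] starts at least two strands
     further right and is a double shift. *)
  have shift2 (r' : piece) : (2 <= pos r')%N ->
      exists r2, r' = shift (shift r2).
    move=> r'2; have [r1 e] := pos_gt0_shift (ltnW r'2); subst r'.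
    by move: r'2; rewrite pos_shift ltnS => /pos_gt0_shift[r2 ->]; exists r2.
  case: p pi => [j b|j|j o] /= ->; rewrite ?add0n ?addn0 ?subn0 ?addn2.
  - move=> _ s s1 s2.
    rewrite -!shift_move_to move_to_pos /= take0 drop0 !step_shift !turn_shift.
    case: (step s r) => //= s' -[<-] [<-].
    by rewrite ?take0 ?drop0 !addbF addbC.
  - move=> /shift2[r' ->]; rewrite !pos_shift !move_to_shift !subSS subn0.
    rewrite move_to_pos => -[|x [|y s]] s1 s2 //=.
    rewrite !step_shift !turn_shift.
    case xy: (x != y); rewrite /= ?drop0;
      case: (step s r') => //= s'; rewrite xy //= drop0 => -[<-] [<-].
    by rewrite !addbF addbC.
  - move=> /shift2[r' ->]; rewrite !pos_shift !move_to_shift !subSS subn0.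
    rewrite -!shift_move_to move_to_pos => -[|x [|y s]] s1 s2 //=.
    rewrite drop0 !step_shift !turn_shift.
    by case: (step s r') => //= s' -[<-] [<-]; rewrite drop0.
have [p' e] : exists p', p = shift p' by apply: pos_gt0_shift; rewrite pi.
subst p; rewrite pi n_in_shift n_out_shift addSn => lt_r.
have [r' e] := pos_gt0_shift (leq_ltn_trans (leq0n _) lt_r); subst r.
move: pi lt_r; rewrite !pos_shift ltnS => -[pi'] le_r.
have := IH p' pi' r'; rewrite pi' => /(_ le_r) {}IH.
have le_in : (n_in p' <= pos r')%N := leq_trans (leq_addl i _) le_r.
rewrite (subSn le_in) addSn move_to_shift -shift_move_to.
apply: (@same_effect_shift [:: r'; p'] [:: p'; move_to _ r']) => //.
by case: (r') => [[|j] b|[|j]|[|j] o].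
Qed.

(** Apart from [rm_far], a move at position 0 meets at most three strands and is settled by running
    both words on a state whose first strands are exposed; [same_effect_shift] then carries it to
    position [i]. *)
Lemma regular_move_same_effect (l r : seq piece) :
  regular_move l r -> same_effect l r.
Proof.
case.
- exact: far_move_same_effect.
- move=> i b; elim: i => [|i IH];
    last exact: (@same_effect_shift [:: Cup i b; Cap i.+1] [::]).
  by case=> [|x s] s1 s2 //=;
    do 3?rewrite ?(take0, drop0) //=; case: b x => -[] [] //= [<-] [<-].
- move=> i b; elim: i => [|i IH];
    last exact: (@same_effect_shift [:: Cup i.+1 b; Cap i] [::]).
  by case=> [|x s] s1 s2 //=;
    do 3?rewrite ?(take0, drop0) //=; case: b x => -[] [] //= [<-] [<-].
- move=> i o; elim: i => [|i IH];
    last exact: (@same_effect_shift [:: Cross i o; Cap i.+1]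
      [:: Cross i.+1 (~~ o); Cap i]).
  by case=> [|x [|y [|z s]]] s1 s2 //=;
    do 3?rewrite ?(take0, drop0) //=; case: x y z => -[] [] [] //= [<-] [<-].
- move=> i b o; elim: i => [|i IH];
    last exact: (@same_effect_shift [:: Cup i.+1 b; Cross i o]
      [:: Cup i b; Cross i.+1 (~~ o)]).
  by case=> [|x [|y [|z s]]] s1 s2 //=;
    do 3?rewrite ?(take0, drop0) //= => -[<-] [<-].
- move=> i o; elim: i => [|i IH];
    last exact: (@same_effect_shift [:: Cross i o; Cross i (~~ o)] [::]).
  by case=> [|x [|y s]] s1 s2 //=;
    do 3?rewrite ?(take0, drop0) //= => -[<-] [<-].
- move=> i a b c _; elim: i => [|i IH];
    last exact: (@same_effect_shift [:: Cross i a; Cross i.+1 b; Cross i c]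
      [:: Cross i.+1 c; Cross i b; Cross i.+1 a]).
  by case=> [|x [|y [|z s]]] s1 s2 //=;
    do 3?rewrite ?(take0, drop0) //= => -[<-] [<-].
Qed.

(** A kink makes one full turn: of its minimum and its maximum, exactly one runs from left to
    right. *)
Lemma run_kink (left : bool) (i : nat) (b o : bool) (s s' : seq bool) :
  run s (kink left i b o) = Some s' ->
  s' = s /\ turning s (kink left i b o).
Proof.
elim: i s s' => [|i IH] s s'.
  case: left => /=.
    case: s => [|x s] //=; do 3?rewrite ?(take0, drop0) //=.
    by case: b x => -[] [] //= [<-].
  case: s => [|x s] //=; do 3?rewrite ?(take0, drop0) //=.
  by case: b x => -[] [] //= [<-].
have -> : kink left i.+1 b o = map shift (kink left i b o) by case: (left).
case: s => [|x s]; first by case: (left).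
move=> /run_shiftP[s1 -> e]; have [-> tu] := IH _ _ e.
by rewrite turning_shift ?e.
Qed.

Lemma run_circle (i : nat) (b : bool) (s s' : seq bool) :
  run s (circle i b) = Some s' -> s' = s /\ turning s (circle i b).
Proof.
elim: i s s' => [|i IH] s s'.
  by rewrite /circle /= take0 drop0; case: b => -[<-]; rewrite /= drop0.
have -> : circle i.+1 b = map shift (circle i b) by [].
case: s => [|x s] //.
move=> /run_shiftP[s1 -> e]; have [-> tu] := IH _ _ e.
by rewrite turning_shift ?e.
Qed.

(** For antiparallel strands oriented [d] and [d'], the cap contributes [d] and the cup [~~ d'];
    these are equal, hence cancel. *)
Lemma run_smoothing (i : nat) (o : bool) (s s' : seq bool) :
  step s (Cross i o) = Some s' ->
  let w := smoothing i (nth true s i) (nth true s i.+1) in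
  run s w = Some s' /\ turning s w = false.
Proof.
elim: i s s' => [|i IH] s s'.
  case: s => [|x [|y s]] //=; rewrite drop0 => -[<-].
  rewrite /smoothing; case: eqVneq => [-> //|xy].
  by rewrite /= xy /= !(take0, drop0); case: x y xy => -[].
case: s => [|x s] //; rewrite -[Cross i.+1 o]/(shift (Cross i o)) step_shift.
case e : (step s (Cross i o)) => [s1|] //= [<-].
have [rs tu] := IH _ _ e.
have -> : smoothing i.+1 (nth true s i) (nth true s i.+1) =
    map shift (smoothing i (nth true s i) (nth true s i.+1)).
  by rewrite /smoothing; case: ifP.
by rewrite run_shift rs turning_shift ?rs.
Qed.

(** * Twisting the HOMFLYPT polynomial by the rotation number *)

Lemma link_diagram_cat (u v : seq piece) : link_diagram (u ++ v) ->
  exists2 s, run [::] u = Some s & run s v = Some [::].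
Proof.
rewrite /link_diagram run_cat; case: (run [::] u) => //= s /eqP e.
by exists s.
Qed.

Definition turning_sign (w : seq piece) : Kqt := (-1) ^+ turning [::] w.

Definition neg_homflypt (H : seq piece -> Kqt) (w : seq piece) : Kqt :=
  turning_sign w * neg_t (H w).

Lemma link_diagram_insert (u m v : seq piece) (s : seq bool) :
  run [::] u = Some s -> run s (m ++ v) = Some [::] ->
  exists s', [/\ run s m = Some s', run s' v = Some [::] &
    turning [::] (u ++ m ++ v) =
    turning [::] u (+) (turning s m (+) turning s' v)].
Proof.
move=> ru; rewrite run_cat; case rm: (run s m) => [s'|] //= rv.
by exists s'; split=> //; rewrite (turning_cat _ ru) (turning_cat _ rm).
Qed.

Lemma neg_t_sub_inv (x y : Kqt) : neg_t x = y -> neg_t (x - x^-1) = y - y^-1.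
Proof. by move=> xy; rewrite neg_tB neg_tV xy. Qed.

Lemma neg_t_unknot :
  neg_t ((t - t^-1) / (q - q^-1)) = - ((t - t^-1) / (q - q^-1)).
Proof.
rewrite neg_tM neg_tV (neg_t_sub_inv neg_t_q) (neg_t_sub_inv neg_t_t).
by rewrite invrN -opprD mulNr.
Qed.

(** In the skein relation the three words have the same turning and [q] is fixed. A kink or a circle
    changes the parity of the turning, and this sign cancels the one that [neg_t] gives to [t],
    [t^-1] and the value of the unknot. *)
Lemma neg_homflypt_axioms (H : seq piece -> Kqt) :
  framed_homflypt_axioms H -> framed_homflypt_axioms (neg_homflypt H).
Proof.
move=> [Hj Hi Hs Hk Hu Hc]; rewrite /neg_homflypt /turning_sign; split.
- by move=> w /Hj ->; rewrite neg_t0 mulr0.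
- move=> u l r v mv dl dr.
  rewrite (Hi _ _ _ _ mv dl dr).
  have [s ru rlv] := link_diagram_cat dl.
  have [s1 [r1 _ ->]] := link_diagram_insert ru rlv.
  have [s' ru' rrv] := link_diagram_cat dr.
  move: ru'; rewrite ru => -[e]; subst s'.
  have [s2 [r2 _ ->]] := link_diagram_insert ru rrv.
  by have [-> ->] := regular_move_same_effect mv r1 r2.
- move=> u v s i ru dc d d'.
  have [s0 ru0 rcv] := link_diagram_cat dc.
  move: ru0; rewrite ru => -[e]; subst s0.
  have [s1 [r1 _ e1]] := link_diagram_insert (m := [:: Cross i true]) ru rcv.
  (* The over/under bit of a crossing affects neither the state nor the turning. *)
  have tc o :
      turning [::] (u ++ Cross i o :: v) = turning [::] u (+) turning s1 v.
    rewrite (turning_cat _ ru) /=; congr (_ (+) _).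
    by move: r1 => /=; case: ifP => //= _ [->].
  have [rs ts] : run s (smoothing i d d') = Some s1 /\
      turning s (smoothing i d d') = false.
    by apply: (@run_smoothing _ true); move: r1 => /=; case: ifP.
  rewrite !tc -mulrBr -neg_tB (Hs _ _ _ _ ru dc) -/d -/d'.
  rewrite (turning_cat _ ru) (turning_cat _ rs) ts addFb.
  by rewrite neg_tM (neg_t_sub_inv neg_t_q) mulrCA.
- move=> u v left i b o dk d.
  rewrite (Hk _ _ _ _ _ _ dk d).
  have [s ru rkv] := link_diagram_cat dk.
  have [s1 [r1 _ ->]] := link_diagram_insert ru rkv.
  have [-> ->] := run_kink r1.
  rewrite (turning_cat _ ru) addTb addbN signrN neg_tM.
  have -> : neg_t (if o then t else t^-1) = - (if o then t else t^-1).
    by case: (o); rewrite ?neg_tV neg_t_t ?invrN.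
  by rewrite !mulNr !mulrN opprK mulrCA.
- move=> b; rewrite Hu neg_t_unknot.
  by case: b; rewrite /= expr1 mulN1r opprK.
- move=> u v i b dk d.
  rewrite (Hc _ _ _ _ dk d).
  have [s ru rkv] := link_diagram_cat dk.
  have [s1 [r1 _ ->]] := link_diagram_insert ru rkv.
  have [-> ->] := run_circle r1.
  rewrite (turning_cat _ ru) addTb addbN neg_tM neg_t_unknot.
  by rewrite signrN !mulNr !mulrN opprK mulrCA.
Qed.

(** Uniqueness forces the invariant to coincide with its twist. In the default branch of [xget] both
    sides vanish. *)
Lemma homflypt_neg_t (w : seq piece) :
  neg_t (homflypt w) = turning_sign w * homflypt w.
Proof.
rewrite /homflypt; case: xgetP => [H _ [HP HU]|_]; last first.
  by rewrite neg_t0 mulr0.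
rewrite {2}(HU _ (neg_homflypt_axioms HP)) /neg_homflypt mulrA.
by rewrite -expr2 sqrr_sign mul1r.
Qed.

(** * Rotation number of satellites *)

Definition shiftn (n : nat) (p : piece) : piece := move_to (n + pos p)%N p.

Lemma shiftnS (n : nat) (p : piece) : shiftn n.+1 p = shift (shiftn n p).
Proof. by case: p. Qed.

Lemma step_shiftn (u s : seq bool) (p : piece) :
  step (u ++ s) (shiftn (size u) p) = omap (cat u) (step s p).
Proof.
elim: u => [|x u IH] /=.
  by rewrite /shiftn add0n move_to_pos; case: step.
by rewrite shiftnS step_shift IH; case: step.
Qed.

Lemma map_shiftnS (n : nat) (w : seq piece) :
  map (shiftn n.+1) w = map shift (map (shiftn n) w).
Proof. by rewrite -map_comp; apply: eq_map => p; exact: shiftnS. Qed.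

Lemma run_shiftn (u s : seq bool) (w : seq piece) :
  run (u ++ s) (map (shiftn (size u)) w) = omap (cat u) (run s w).
Proof.
elim: u => [|x u IH].
  rewrite (eq_map (g := id)) ?map_id /=; first by case: run.
  by move=> p; rewrite /shiftn add0n move_to_pos.
by rewrite map_shiftnS run_shift IH; case: run.
Qed.

Lemma turning_shiftn (u s : seq bool) (w : seq piece) : run s w ->
  turning (u ++ s) (map (shiftn (size u)) w) = turning s w.
Proof.
move=> rw; elim: u => [|x u IH].
  rewrite (eq_map (g := id)) ?map_id //.
  by move=> p; rewrite /shiftn add0n move_to_pos.
by rewrite map_shiftnS turning_shift ?IH // run_shiftn; case: run rw.
Qed.

(** The final state and the parity of the turning are bundled, so that both compose at once under
    concatenation. *)
Definition has_effect (s : seq bool) (w : seq piece) (s' : seq bool)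
    (e : bool) : Prop :=
  run s w = Some s' /\ turning s w = e.

Lemma has_effect_nil (s : seq bool) : has_effect s [::] s false.
Proof. by []. Qed.

Lemma has_effect_step (s s' : seq bool) (p : piece) : step s p = Some s' ->
  has_effect s [:: p] s' (turn s p).
Proof. by rewrite /has_effect /= addbF => ->. Qed.

Lemma has_effect_cat (s s1 s2 : seq bool) (u v : seq piece) (e f : bool) :
  has_effect s u s1 e -> has_effect s1 v s2 f ->
  has_effect s (u ++ v) s2 (e (+) f).
Proof.
by move=> [ru <-] [rv <-]; split; rewrite ?run_cat ?ru // (turning_cat _ ru).
Qed.

Lemma has_effect_shiftn (u s s' : seq bool) (w : seq piece) (e : bool) :
  has_effect s w s' e ->
  has_effect (u ++ s) (map (shiftn (size u)) w) (u ++ s') e.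
Proof.
by move=> [rw <-]; split; rewrite ?run_shiftn ?rw ?turning_shiftn ?rw.
Qed.

Lemma step_cup0 (b : bool) (s : seq bool) :
  step s (Cup 0 b) = Some (b :: ~~ b :: s).
Proof. by rewrite /= take0 drop0. Qed.

Lemma nseq_cons (T : Type) (n : nat) (x : T) (s : seq T) :
  nseq n x ++ x :: s = x :: nseq n x ++ s.
Proof. by elim: n => //= n ->. Qed.

(** The cups come from the outermost to the innermost, each one being inserted in the middle of the
    strands already created. *)
Lemma nested_cups (b : bool) (s : seq bool) (n : nat) :
  has_effect s [seq Cup k b | k <- iota 0 n]
    (nseq n b ++ nseq n (~~ b) ++ s) (odd n && ~~ b).
Proof.
elim: n s => [|n IH] s; first exact: has_effect_nil.
rewrite -addn1 iotaD map_cat addn1 oddS.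
have -> : ~~ odd n && ~~ b = (odd n && ~~ b) (+) ~~ b.
  by case: (odd n) (b) => -[].
apply: has_effect_cat (IH s) _.
have := has_effect_shiftn (nseq n b) 
  (has_effect_step (step_cup0 b (nseq n (~~ b) ++ s))).
rewrite size_nseq /= /shiftn /= addn0 add0n.
by rewrite nseq_cons.
Qed.

(** Dually to the cups, the innermost pair is closed first, whence the reversed list. *)
Lemma nested_caps (x : bool) (s : seq bool) (n : nat) :
  has_effect (nseq n x ++ nseq n (~~ x) ++ s)
    [seq Cap k | k <- rev (iota 0 n)] s (odd n && x).
Proof.
elim: n => [|n IH]; first exact: has_effect_nil.
rewrite -{3}addn1 iotaD rev_cat map_cat oddS.
have -> : ~~ odd n && x = x (+) (odd n && x) by case: (odd n) (x) => -[].
apply: has_effect_cat IH.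
have xx : x != ~~ x by case: x.
have h : step (x :: ~~ x :: nseq n (~~ x) ++ s) (Cap 0) =
    Some (nseq n (~~ x) ++ s).
  by rewrite /= xx drop0.
have := has_effect_shiftn (nseq n x) (has_effect_step h).
rewrite size_nseq /= /shiftn /= addn0 add0n.
by rewrite nseq_cons.
Qed.

Lemma strand_crossings (o x y : bool) (s : seq bool) (n : nat) :
  has_effect (x :: nseq n y ++ s) [seq Cross k o | k <- iota 0 n]
    (nseq n y ++ x :: s) false.
Proof.
elim: n => [|n IH]; first exact: has_effect_nil.
rewrite /= -[1%N]addn0 iotaDl -map_comp.
apply: (@has_effect_cat _ (y :: x :: nseq n y ++ s) _ [:: Cross 0 o] _
  false false).
  by split=> //=; rewrite drop0.
have := has_effect_shiftn [:: y] IH.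
by rewrite -map_comp.
Qed.

(** The rightmost strand of the first bundle is carried across the second bundle first; induction
    treats the others. *)
Lemma parallel_crossings (o x y : bool) (s : seq bool) (n m : nat) :
  has_effect (nseq n x ++ nseq m y ++ s)
    [seq Cross (a + b)%N o | a <- rev (iota 0 n), b <- iota 0 m]
    (nseq m y ++ nseq n x ++ s) false.
Proof.
elim: n s => [|n IH] s; first exact: has_effect_nil.
rewrite -{2}addn1 iotaD rev_cat /= add0n.
apply: (@has_effect_cat _ (nseq n x ++ nseq m y ++ x :: s) _ _ _ false false).
  have := has_effect_shiftn (nseq n x) (strand_crossings o x y s m).
  by rewrite size_nseq -map_comp nseq_cons.
by have := IH (x :: s); rewrite nseq_cons.
Qed.

Definition parallel_state (N : nat) (s : seq bool) : seq bool :=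
  flatten (map (nseq N) s).

Lemma parallel_piece_shift (N : nat) (p : piece) :
  parallel_piece N (shift p) = map (shiftn N) (parallel_piece N p).
Proof.
case: p => [i b|i|i o] /=.
- by rewrite -map_comp; apply: eq_map => k /=; rewrite /shiftn /= mulnS addnA.
- by rewrite -map_comp; apply: eq_map => k /=; rewrite /shiftn /= mulnS addnA.
- rewrite map_allpairs; apply: eq_allpairs => a b.
  by rewrite /shiftn /= mulnS !addnA.
Qed.

(** An extremum becomes [N] nested extrema with the same turn, and a crossing becomes crossings
    only. The induction on the position shifts by a whole bundle of [N] strands. *)
Lemma parallel_step (N : nat) (s s' : seq bool) (p : piece) :
  step s p = Some s' ->
  has_effect (parallel_state N s) (parallel_piece N p) (parallel_state N s')
    (odd N && turn s p).
Proof.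
elim: {p}(pos p) {-2}p (erefl (pos p)) s s' => [|i IH] p pi s s' st; last first.
  have [p' e] : exists p', p = shift p' by apply: pos_gt0_shift; rewrite pi.
  subst p; move: pi; rewrite pos_shift => -[pi].
  case: s st => [|x s]; first by case: (p').
  rewrite step_shift; case e: (step s p') => [s1|] //= [<-].
  rewrite parallel_piece_shift turn_shift.
  by have := has_effect_shiftn (nseq N x) (IH _ pi _ _ e); rewrite size_nseq.
case: p pi st => [j b|j|j o] /= -> /=.
- move=> [<-]; rewrite take0 drop0 muln0 /=.
  exact: nested_cups.
- case: s => [|x [|y s]] //=; case: ifP => // xy -[<-]; rewrite drop0 muln0 /=.
  have -> : y = ~~ x by case: x y xy => -[].
  exact: nested_caps.
- case: s => [|x [|y s]] //= -[<-]; rewrite drop0 muln0 andbF /=.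
  exact: parallel_crossings.
Qed.

Lemma parallel_run (N : nat) (s s' : seq bool) (w : seq piece) :
  run s w = Some s' ->
  has_effect (parallel_state N s) (flatten [seq parallel_piece N p | p <- w])
    (parallel_state N s') (odd N && turning s w).
Proof.
elim: w s => [s [<-]|p w IH s] /=.
  by rewrite andbF; exact: has_effect_nil.
case st: (step s p) => [s1|] //= /IH h; rewrite andb_addr.
exact: has_effect_cat (parallel_step N st) h.
Qed.

Lemma step_cross_same (s : seq bool) (i : nat) (o : bool) :
  (i.+1 < size s)%N -> nth true s i = nth true s i.+1 ->
  step s (Cross i o) = Some s.
Proof.
move=> lt_i e; rewrite /= lt_i {1}e -{1}e.
have lt_i' := ltnW lt_i.
by rewrite -!drop_nth // cat_take_drop.
Qed.

(** All the strands of the braid point upwards, so each crossing exchanges equal orientations and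
    fixes the state. *)
Lemma braid_has_effect (N : nat) (u s : seq bool) (x : braid_word N) :
  has_effect (u ++ nseq N true ++ s) (braid_at (size u) x)
    (u ++ nseq N true ++ s) false.
Proof.
elim: x => [|[l o] x IH]; first exact: has_effect_nil.
have lN : (l.+1 < N)%N by case: N l {x IH} => [|[|N]] [].
apply: (@has_effect_cat _ (u ++ nseq N true ++ s) _
  [:: shiftn (size u) (Cross l o)] _ false false _ IH).
apply: (@has_effect_step _ _ (shiftn (size u) (Cross l o))).
rewrite step_shiftn step_cross_same // ?size_cat ?size_nseq ?ltn_addr //.
by rewrite !nth_cat size_nseq lN (ltnW lN) !nth_nseq !if_same.
Qed.

Lemma turning_satellite (N : nat) (w : seq piece) (x : braid_word N) :
  link_diagram w -> turning [::] (satellite w x) = odd N && turning [::] w.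
Proof.
case: w => [|[i b|i|i o] w] //; first by rewrite andbF.
rewrite /link_diagram /=; case: ifP => //; rewrite leqn0 => /eqP -> /eqP rw.
have := @parallel_run N [:: b; ~~ b] [::] w rw.
rewrite /parallel_state /= !cats0 => h3.
(* The braid sits on the upward bundle: the left one, at offset 0, if [b] holds, and otherwise the
   right one, at offset [N]. *)
have h2 : has_effect (nseq N b ++ nseq N (~~ b))
    (braid_at (N * (if b then 0 else 1))%N x) (nseq N b ++ nseq N (~~ b)) false.
  case: (b).
    by have := braid_has_effect [::] (nseq N false) x; rewrite muln0.
  have := braid_has_effect (nseq N false) [::] x.
  by rewrite size_nseq muln1 cats0.
have := nested_cups b [::] N; rewrite cats0 => h1.
have [_] := has_effect_cat h1 (has_effect_cat h2 h3).
rewrite andb_addr muln0 => <-.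
by congr (turning _ (_ ++ _)); apply: eq_map => k; rewrite muln0.
Qed.

(** * Rotation number, writhe and number of components *)

(** Parity of the number of inversions: for distinct entries, the sign of the permutation that sorts
    the list. *)
Fixpoint inv_odd (s : seq nat) : bool :=
  if s is x :: s' then odd (count (fun y => y < x)%N s') (+) inv_odd s'
  else false.

Lemma inv_odd_swap (u v : seq nat) (x y : nat) : x != y ->
  inv_odd (u ++ x :: y :: v) = ~~ inv_odd (u ++ y :: x :: v).
Proof.
move=> xy; elim: u => [|z u IH] /=.
  rewrite !oddD; case: ltngtP xy => // _ _ /=;
  by case: (odd (count _ v)) (odd (count _ v)) (inv_odd v) => -[] [].
by rewrite IH addbN !count_cat /= !addnA -!(addnC (y < z)%N) !addnA.
Qed.

Lemma inv_odd_move (u m v : seq nat) (x : nat) : x \notin m ->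
  inv_odd (u ++ x :: m ++ v) = odd (size m) (+) inv_odd (u ++ m ++ x :: v).
Proof.
elim: m u => [|y m IH] u //=; rewrite inE negb_or => /andP[xy xm].
rewrite inv_odd_swap // -[in RHS]cat_rcons -[u ++ y :: _]cat_rcons IH //.
by rewrite addNb.
Qed.

Lemma inv_odd_exchange (u m v : seq nat) (x y : nat) :
  x != y -> x \notin m -> y \notin m ->
  inv_odd (u ++ x :: m ++ y :: v) = ~~ inv_odd (u ++ y :: m ++ x :: v).
Proof.
move=> xy xm ym; rewrite inv_odd_move // [in RHS]inv_odd_move // !catA.
by rewrite inv_odd_swap // -addbN.
Qed.

(** Two entries moved past [u] make [2 * size u] transpositions, an even number. *)
Lemma inv_odd_front (u v : seq nat) (x y : nat) : x \notin u -> y \notin u ->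
  inv_odd (u ++ x :: y :: v) = inv_odd (x :: y :: u ++ v).
Proof.
move=> xu yu; have := inv_odd_move [:: x] v yu; rewrite /= => ->.
have := inv_odd_move [::] (y :: v) xu; rewrite /= => ->.
by rewrite addbA addbb.
Qed.

(** Each entry of [l] forms an inversion with both of [x] and [y] or with neither, so only the order
    of [x] and [y] counts. *)
Lemma inv_odd_pair (l : seq nat) (x y : nat) :
  {in l, forall z, (z < x)%N = (z < y)%N} ->
  inv_odd (x :: y :: l) = (y < x)%N (+) inv_odd l.
Proof.
move=> xy /=; rewrite oddD oddb (eq_in_count xy).
by rewrite addbA -[_ (+) _ (+) odd _]addbA addbb addbF.
Qed.

(* The invariant is the sign of the permutation that lists, arc by arc, the
   upward end and then the downward end of the arcs of an open diagram. *)
Definition end_key (x : nat * bool) : nat := (x.1.*2 + ~~ x.2)%N.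

Lemma end_key_inj : injective end_key.
Proof.
move=> [a o] [b o']; rewrite /end_key /= => e.
have : odd (a.*2 + ~~ o) = odd (b.*2 + ~~ o') by rewrite e.
rewrite !oddD !odd_double !oddb /= => /negb_inj oo; subst o'.
by move: e => /addIn /double_inj ->.
Qed.

Definition end_inv (S : seq (nat * bool)) : bool := inv_odd (map end_key S).

Lemma odd_absD1 (e z : int) : (e == 1) || (e == -1) ->
  odd `|(e + z)%R|%N = ~~ odd `|z|%N.
Proof. by case/orP => /eqP ->; lia.
Qed.

Lemma cat2_access (T : Type) (d : T) (u v : seq T) (x y : T)
    (s := u ++ x :: y :: v) :
  [/\ take (size u) s = u, drop (size u).+2 s = v, nth d s (size u) = x,
    nth d s (size u).+1 = y & (size u).+1 < size s]%N.
Proof.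
rewrite /s; split.
- exact: take_size_cat.
- by rewrite -addn2 addnC -drop_drop drop_size_cat //= drop0.
- by rewrite nth_cat ltnn subnn.
- by rewrite nth_cat ltnNge leqnSn /= subSnn.
- by rewrite size_cat /= !addnS !ltnS leq_addr.
Qed.

Lemma end_inv_swap (u v : seq (nat * bool)) (x y : nat * bool) : x != y ->
  end_inv (u ++ x :: y :: v) = ~~ end_inv (u ++ y :: x :: v).
Proof.
by move=> xy; rewrite /end_inv !map_cat /= inv_odd_swap ?(inj_eq end_key_inj).
Qed.

Lemma end_inv_front (u v : seq (nat * bool)) (x y : nat * bool) :
  x \notin u -> y \notin u ->
  end_inv (u ++ x :: y :: v) = end_inv (x :: y :: u ++ v).
Proof.
move=> xu yu; rewrite /end_inv /= !map_cat /= inv_odd_front //.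
- by rewrite (mem_map end_key_inj).
- by rewrite (mem_map end_key_inj).
Qed.

Lemma end_inv_pair (a : nat) (o : bool) (s : seq (nat * bool)) :
  {in s, forall x, x.1 != a} ->
  end_inv ((a, o) :: (a, ~~ o) :: s) = ~~ o (+) end_inv s.
Proof.
move=> sa; rewrite /end_inv [map _ _]/= inv_odd_pair.
  by congr (_ (+) _); rewrite /end_key /=; case: (o); rewrite /=; lia.
move=> _ /mapP[[b o'] /sa /= ba ->]; rewrite /end_key /=.
by case: o o' => -[] /=; lia.
Qed.

(** Each label in use occurs exactly twice, once with each orientation: the two ends of an oriented
    arc. *)
Definition matched (fresh : nat) (s : seq (nat * bool)) : Prop :=
  [/\ uniq s, forall a o, (a, o) \in s -> (a, ~~ o) \in s &
    forall x, x \in s -> (x.1 < fresh)%N].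

Lemma matched_remove (fresh a : nat) (s s' : seq (nat * bool)) :
  matched fresh s -> uniq s' ->
  (forall x, (x \in s') = (x \in s) && (x.1 != a)) -> matched fresh s'.
Proof.
move=> [_ cl lt] us' e; split=> // [c o|x].
  by rewrite !e /= => /andP[/cl -> ->].
by rewrite e => /andP[/lt].
Qed.

(** The adjacent new ends can be brought to the front without changing the sign, and their keys are
    consecutive, so they contribute only their own order. *)
Lemma matched_cup (fresh : nat) (u v : seq (nat * bool)) (b : bool) :
  matched fresh (u ++ v) ->
  let s' := u ++ (fresh, b) :: (fresh, ~~ b) :: v in
  matched fresh.+1 s' /\ end_inv s' = ~~ b (+) end_inv (u ++ v).
Proof.
move=> [un cl lt] s'.
have nin o : (fresh, o) \notin u ++ v by apply/negP => /lt /=; rewrite ltnn.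
have ninu o : (fresh, o) \notin u.
  by have := nin o; rewrite mem_cat negb_or => /andP[].
have ninv o : (fresh, o) \notin v.
  by have := nin o; rewrite mem_cat negb_or => /andP[].
have ps : perm_eq s' ((fresh, b) :: (fresh, ~~ b) :: u ++ v).
  rewrite /s' -[(fresh, b) :: _ :: v]/([:: (fresh, b); (fresh, ~~ b)] ++ v).
  by rewrite perm_catCA.
split; last first.
  rewrite /s' end_inv_front // end_inv_pair // => x /lt; rewrite ltn_neqAle.
  by case/andP.
split.
- rewrite (perm_uniq ps) /= inE negb_or !nin un !andbT.
  by rewrite xpair_eqE eqxx; case: (b).
- move=> a o; rewrite !(perm_mem ps) !inE.
  case/or3P => [/eqP[-> ->]|/eqP[-> ->]|/cl ->].
  + by rewrite eqxx orbT.
  + by rewrite negbK eqxx.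
  + by rewrite !orbT.
- move=> x; rewrite !(perm_mem ps) !inE => /or3P[/eqP ->|/eqP ->|/lt /ltnW] //=.
Qed.

Lemma matched_cross (fresh : nat) (u v : seq (nat * bool)) (x y : nat * bool) :
  matched fresh (u ++ x :: y :: v) ->
  matched fresh (u ++ y :: x :: v) /\
  end_inv (u ++ y :: x :: v) = ~~ end_inv (u ++ x :: y :: v).
Proof.
move=> [un cl lt].
have ps : perm_eq (u ++ y :: x :: v) (u ++ x :: y :: v).
  by rewrite perm_cat2l -[y :: _]/([:: y] ++ [:: x] ++ v) perm_catCA.
have xy : y != x.
  move: un; rewrite cat_uniq => /and3P[_ _ /=].
  by rewrite inE negb_or eq_sym => /andP[/andP[]].
split; last exact: end_inv_swap.
split=> [|a o|z]; first by rewrite (perm_uniq ps).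
- by rewrite !(perm_mem ps) => /cl.
- by rewrite (perm_mem ps) => /lt.
Qed.

Lemma matched_cap_same (fresh a : nat) (o : bool) (u v : seq (nat * bool)) :
  matched fresh (u ++ (a, o) :: (a, ~~ o) :: v) ->
  matched fresh (u ++ v) /\
  end_inv (u ++ (a, o) :: (a, ~~ o) :: v) = ~~ o (+) end_inv (u ++ v).
Proof.
set s := _ ++ _ => ms; have [un cl lt] := ms.
have ps : perm_eq s ((a, o) :: (a, ~~ o) :: u ++ v).
  by rewrite /s -[(a, o) :: _ :: v]/([:: (a, o); (a, ~~ o)] ++ v) perm_catCA.
have nin o' : (a, o') \notin u ++ v.
  move: un; rewrite (perm_uniq ps) /= inE negb_or => /and3P[/andP[_ n1] n2 _].
  by case: o o' {ps s ms cl lt} n1 n2 => -[].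
have na : {in u ++ v, forall x, x.1 != a}.
  by move=> [c o'] xin /=; apply: contraTneq xin => ->.
split.
  apply: (matched_remove (a := a) ms).
    by move: un; rewrite (perm_uniq ps) /= => /and3P[].
  move=> x; rewrite (perm_mem ps) !inE.
  case: (boolP (x \in u ++ v)) => [/na ->|]; first by rewrite !orbT.
  rewrite orbF; case: x => c o' /= _.
  by rewrite !xpair_eqE; case: (c == a); rewrite /= ?andbF.
rewrite /s end_inv_front ?end_inv_pair //.
- by have := nin o; rewrite mem_cat negb_or => /andP[].
- by have := nin (~~ o); rewrite mem_cat negb_or => /andP[].
Qed.

(** The joined arc keeps the label [a], its other end being the far end of the arc [b]. Exchanging
    the entries [(a, o)] and [(b, o)], an odd permutation, reduces to the removal of a pair with the
    single label [b]. *)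
Lemma matched_cap_join (fresh a b : nat) (o : bool) (u v : seq (nat * bool)) :
  a != b -> matched fresh (u ++ (a, o) :: (b, ~~ o) :: v) ->
  let s' := [seq (if x.1 == b then a else x.1, x.2) | x <- u ++ v] in
  matched fresh s' /\
  end_inv (u ++ (a, o) :: (b, ~~ o) :: v) = o (+) end_inv s'.
Proof.
move=> ab; set s := _ ++ _ => ms; have [un cl lt] := ms.
have ps : perm_eq s ((a, o) :: (b, ~~ o) :: u ++ v).
  by rewrite /s -[(a, o) :: _ :: v]/([:: (a, o); (b, ~~ o)] ++ v) perm_catCA.
(* The far end of the arc [b], which gets the label [a] in [s']. *)
have b_in : (b, o) \in u ++ v.
  have : (b, o) \in s.
    by rewrite -(negbK o); apply: cl; rewrite (perm_mem ps) !inE eqxx orbT.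
  rewrite (perm_mem ps) !inE !xpair_eqE eqxx (eq_sym b) (negPf ab) /=.
  by rewrite eqxx; case: (o).
have un' := un; rewrite (perm_uniq ps) in un'.
have e_front : end_inv s = end_inv ((a, o) :: (b, ~~ o) :: u ++ v).
  apply: end_inv_front; apply: contraTN un' => xu /=.
    by rewrite inE mem_cat xu !orbT.
  by rewrite mem_cat xu andbF.
rewrite {}e_front; move: (u ++ v) ps b_in un' => l ps b_in.
case/splitPr: b_in ps => p r ps un' s'.
have ps2 : perm_eq s [:: (a, o), (b, o), (b, ~~ o) & p ++ r].
  apply: perm_trans ps _; rewrite perm_cons perm_sym.
  rewrite (perm_catCA [:: (b, o)] [:: (b, ~~ o)]) perm_cons perm_sym.
  by rewrite (perm_catCA p [:: (b, o)]).
have un2 := un; rewrite (perm_uniq ps2) in un2.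
have nb : {in p ++ r, forall x, x.1 != b}.
  move: un2 => /= /and4P[_ n1 n2 _] [c o'] xin /=; apply: contraTneq xin => ->.
  move: n1; rewrite inE negb_or => /andP[_ n1].
  by have [->|->] : o' = o \/ o' = ~~ o by case: (o) (o') => -[]; auto.
have id_on (w : seq (nat * bool)) : {subset w <= p ++ r} ->
    [seq (if x.1 == b then a else x.1, x.2) | x <- w] = w.
  move=> sw; apply: map_id_in => -[c o'] /sw/nb /=.
  by move/negPf ->.
have s'E : s' = p ++ (a, o) :: r.
  rewrite /s' map_cat /= eqxx !id_on // => x; rewrite mem_cat => ->//.
  by rewrite orbT.
have ps' : perm_eq s' ((a, o) :: p ++ r).
  by rewrite s'E (perm_catCA p [:: (a, o)]).
split.
  apply: (matched_remove (a := b) ms).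
    rewrite (perm_uniq ps'); move: un2 => /= /and4P[+ _ _ ->].
    by rewrite !inE !negb_or => /and3P[_ _ ->].
  move=> x; rewrite (perm_mem ps2) (perm_mem ps') !inE.
  case: (boolP (x \in p ++ r)) => [/nb ->|_]; first by rewrite !orbT.
  case: x => c o'; rewrite !xpair_eqE /= !orbF.
  case: (eqVneq c b) => [->|_]; last by rewrite !orbF andbT.
  by rewrite eq_sym (negPf ab) andbF.
rewrite s'E.
(* The transposition leaves [s'] behind two adjacent ends of [b]. *)
have -> : end_inv ((a, o) :: (b, ~~ o) :: p ++ (b, o) :: r) =
    ~~ end_inv ((b, o) :: (b, ~~ o) :: p ++ (a, o) :: r).
  rewrite /end_inv /= !map_cat /=.
  apply: (inv_odd_exchange [::] (m := _ :: _));
    rewrite -?map_cons ?(mem_map end_key_inj).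
  - by rewrite (inj_eq end_key_inj) xpair_eqE (negPf ab).
  - move: un2 => /= /and4P[].
    rewrite !inE !mem_cat !negb_or => /and4P[_ ? ? _] *.
    by apply/andP.
  - move: un2 => /= /and4P[_].
    rewrite !inE !mem_cat !negb_or => /and3P[? ? _] *.
    by apply/andP.
rewrite end_inv_pair ?addNb ?negbK // => x.
rewrite -(perm_mem (s1 := (a, o) :: p ++ r)) ?inE; last first.
  by rewrite perm_sym (perm_catCA p [:: (a, o)]).
by case/orP => [/eqP ->|/nb].
Qed.

Lemma split_two (T : Type) (i : nat) (s : seq T) : (i.+1 < size s)%N ->
  exists u x y v, s = u ++ x :: y :: v /\ i = size u.
Proof.
move=> lt_i; have := cat_take_drop i s.
have : size (drop i s) = (size s - i)%N by rewrite size_drop.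
case: (drop i s) => [|x [|y v]] /=; [lia|lia|] => _ e.
by exists (take i s), x, y, v; rewrite e size_takel //; lia.
Qed.

(** What remains to be read determines the sign of the current state. A cup changes both sides by
    its turn, a crossing by one through the writhe, a cap joining two arcs by its turn, and a cap
    closing an arc by its turn plus one for the new component. *)
Lemma turning_writhe_ncomp_from (w : seq piece) (fresh : nat)
    (s : seq (nat * bool)) :
  matched fresh s -> run (map snd s) w = Some [::] ->
  turning (map snd s) w (+) odd `|writhe_from (map snd s) w|%N
    (+) odd (ncomp_from fresh (map fst s) w) = end_inv s.
Proof.
elim: w fresh s => [|p w IH] fresh s ms.
  by case: s ms => [|x s].
case: p => [i b|i|i o].
- rewrite /=; case: ifP => //= le_i.
  rewrite size_map in le_i.
  rewrite -!map_take -!map_drop.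
  have := cat_take_drop i s.
  move: (take i s) (drop i s) => u v e; subst s.
  have [ms' e] := matched_cup b ms.
  have := IH _ _ ms'; rewrite !map_cat /= => IH' /IH'.
  rewrite e add0r => {}IH.
  by rewrite -!addbA; rewrite -!addbA in IH; rewrite IH addbA addbb.
- rewrite /=; case: ifP => //= /andP[lt_i].
  rewrite size_map in lt_i.
  have [u [[a o] [[b o'] [v [e eu]]]]] := split_two lt_i; subst s i.
  rewrite !map_cat /= -(size_map snd u).
  have [-> -> -> -> _] := cat2_access true (map snd u) (map snd v) o o'.
  rewrite size_map -(size_map fst u).
  have [-> -> -> -> _] := cat2_access 0%N (map fst u) (map fst v) a b.
  rewrite add0r => oo'; have eo : o' = ~~ o by case: o o' oo' {lt_i ms} => -[].
  subst o'; case: eqVneq => [e|ab] r.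
    subst b; have [ms' ->] := matched_cap_same ms.
    have := IH _ _ ms'; rewrite !map_cat => /(_ r) <- /=.
    by case: (o) (turning _ _) (odd _) (odd _) => -[] [] [].
  have [ms' ->] := matched_cap_join ab ms.
  have := IH _ _ ms'; rewrite -!map_comp.
  rewrite (eq_map (f := snd \o _) (g := snd)) // !map_cat => /(_ r) <- /=.
  by rewrite -!addbA; congr (_ (+) (_ (+) (_ (+) odd (ncomp_from _ _ _)))).
- rewrite /=; case: ifP => // lt_i.
  rewrite size_map in lt_i.
  have [u [[a d] [[b d'] [v [e eu]]]]] := split_two lt_i; subst s i.
  rewrite !map_cat /= -(size_map snd u).
  have [-> -> -> -> _] := cat2_access true (map snd u) (map snd v) d d'.
  rewrite size_map -(size_map fst u).
  have [-> -> -> -> _] := cat2_access 0%N (map fst u) (map fst v) a b.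
  move=> r; have [ms' e] := matched_cross ms.
  have := IH _ _ ms'; rewrite e !map_cat => /(_ r).
  rewrite odd_absD1; last by case: ifP.
  by rewrite /= addbN addNb => ->; rewrite negbK.
Qed.

(** Whitney's parity relation for links: the initial state is empty and has trivial sign. *)
Lemma turning_writhe_ncomp (w : seq piece) : link_diagram w ->
  turning [::] w (+) odd `|writhe w|%N = odd (ncomp w).
Proof.
move=> /eqP rw; have m0 : matched 0 [::] by [].
have /= := turning_writhe_ncomp_from m0 rw; rewrite -/(writhe w) -/(ncomp w).
by case: (turning _ _) (odd `|writhe w|%N) (odd (ncomp w)) => -[] [].
Qed.

(** * Evenness in t of the quotient W / S *)

Lemma exprzN (F : fieldType) (x : F) (z : int) :
  (- x) ^ z = (-1) ^+ odd `|z|%N * x ^ z.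
Proof.
case: z => n.
  by rewrite -[LHS]/((- x) ^+ n) -[x ^ _]/(x ^+ n) signr_odd -exprNn.
rewrite -[LHS]/(((- x) ^+ n.+1)^-1) -[x ^ _]/((x ^+ n.+1)^-1).
by rewrite signr_odd -invr_sign -invfM -exprNn.
Qed.

(** Kept over an abstract domain, like the morphism lemmas for [neg_t], to avoid rewriting in
    [Kqt]. *)
Lemma neg_t_framed (A : idomainType) (x y h : {fraction {poly A}}) (a b : int)
    (e : bool) :
  neg_t x = x -> neg_t y = - y -> neg_t h = (-1) ^+ e * h ->
  neg_t (x ^ a * y ^ b * h) = (-1) ^+ (odd `|b|%N (+) e) * (x ^ a * y ^ b * h).
Proof.
move=> nx ny nh; rewrite !neg_tM !neg_tXz nx ny nh exprzN signr_addb.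
by rewrite [x ^ a * (_ * _)]mulrCA mulrACA.
Qed.

Lemma homflypt_row_neg_t (N : nat) (w : seq piece) : link_diagram w ->
  neg_t (homflypt_row N w) =
    (-1) ^+ (odd N && turning [::] w) * homflypt_row N w.
Proof.
move=> dw; rewrite /homflypt_row neg_t_sum mulr_sumr; apply: eq_bigr => x _.
rewrite neg_tM neg_t_const homflypt_neg_t /turning_sign turning_satellite //.
exact: mulrCA.
Qed.

(** The framing factor gives the parity of [N * writhe w] and the satellite that of [N] times the
    rotation number; for a knot the two factors of [N] add up to an odd number. *)
Lemma W_row_neg_t (N : nat) (w : seq piece) : knot_diagram w ->
  neg_t (W_row N w) = (-1) ^+ odd N * W_row N w.
Proof.
move=> /andP[dw /eqP n1]; have := turning_writhe_ncomp dw; rewrite n1 => e.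
have odd_w : odd `|- (N%:Z * writhe w)|%N (+) (odd N && turning [::] w) = odd N.
  rewrite abszN abszM oddM /=; move: e.
  by case: (odd N) (turning _ _) (odd `|writhe w|%N) => -[] [].
rewrite -odd_w.
exact: neg_t_framed neg_t_q neg_t_t (homflypt_row_neg_t N dw).
Qed.

(** The unknot diagram is a knot diagram too, so numerator and denominator carry the same sign. *)
Lemma neg_t_W_div_S (N : nat) (w : seq piece) : knot_diagram w ->
  neg_t (W_row N w / S_row N) = W_row N w / S_row N.
Proof.
move=> kw; rewrite neg_tM neg_tV /S_row !W_row_neg_t //.
by rewrite invfM mulrACA divff ?signr_eq0 // mul1r.
Qed.

(** * Parity of the exponents of t *)

Lemma coef_comp_poly_oppX (A : comNzRingType) (p : {poly A}) (k : nat) :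
  (p \Po - 'X)`_k = (-1) ^+ k * p`_k.
Proof.
rewrite comp_polyE coef_sum.
have term (i : nat) : (p`_i *: (- 'X) ^+ i)`_k = p`_i * (-1) ^+ i *+ (k == i).
  have -> : (- 'X) ^+ i = ((-1) ^+ i)%:P * 'X^i :> {poly A}.
    by rewrite [LHS]exprNn polyC_exp polyCN polyC1.
  by rewrite coefZ mul_polyC coefZ coefXn mulrnAr mulr1 mulrnAr.
under eq_bigr => i _ do rewrite term.
have [lt_k|le_k] := ltnP k (size p); last first.
  rewrite big1 ?nth_default ?mulr0 // => i _.
  by rewrite [k == i]gtn_eqF ?mulr0n // (leq_trans (ltn_ord i)).
rewrite (bigD1 (Ordinal lt_k)) //= big1 => [|i].
  by rewrite addr0 eqxx mulr1n mulrC.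
by rewrite -val_eqE eq_sym => /negPf /= ->; rewrite mulr0n.
Qed.

(** Clearing denominators gives [p(-X) = (-1)^j p(X)], and the coefficients of degree [k] are
    compared. The factor 2 stays because the characteristic is arbitrary here. *)
Lemma neg_t_fixed_coef (A : idomainType) (p : {poly A})
    (c : {fraction {poly A}}) (j k : nat) (x := tofrac p / c / tofrac 'X ^+ j) :
  c != 0 -> neg_t c = c -> neg_t x = x -> odd k != odd j -> p`_k *+ 2 = 0.
Proof.
move=> c0 nc; rewrite /x !neg_tM !neg_tV neg_tX !neg_t_poly nc comp_polyX.
have X0 : tofrac ('X : {poly A}) != 0 by rewrite tofrac_eq0 polyX_eq0.
rewrite tofracN [(- _) ^+ j]exprNn invfM invr_sign mulrA.
move/(mulIf (invr_neq0 (expf_neq0 j X0))); rewrite mulrAC.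
move/(mulIf (invr_neq0 c0)).
have -> : (-1) ^+ j = tofrac ((-1) ^+ j) :> {fraction {poly A}}.
  by rewrite rmorph_sign.
rewrite -tofracM => /eqP; rewrite tofrac_eq => /eqP e kj.
have := congr1 (fun r : {poly A} => r`_k) e.
have -> : (-1) ^+ j = ((-1) ^+ j)%:P :> {poly A} by rewrite rmorph_sign.
rewrite coefMC coef_comp_poly_oppX mulrAC -signr_odd -[(-1) ^+ j]signr_odd.
rewrite -signr_addb.
have -> : odd k (+) odd j by case: (odd k) (odd j) kj => -[].
by rewrite mulN1r mulr2n => {1}<-; rewrite addNr.
Qed.

(** Expresses that [t^-j P] contains only even powers of [t]. *)
Definition t_parity (P : {poly {poly int}}) (j : nat) : Prop :=
  forall k, odd k != odd j -> P`_k = 0.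

Lemma laurent_frac_parity (P : {poly {poly int}}) (i j : nat) :
  neg_t (laurent_frac (P, i, j)) = laurent_frac (P, i, j) -> t_parity P j.
Proof.
have q0 : q ^+ i != 0.
  by rewrite expf_neq0 // tofrac_eq0 polyC_eq0 tofrac_eq0 polyX_eq0.
have nq : neg_t (q ^+ i) = q ^+ i by rewrite neg_tX neg_t_q.
move=> e k kj; have := neg_t_fixed_coef q0 nq e kj.
(* The coefficients are integer polynomials, where the factor 2 can be cancelled. *)
rewrite coef_map -tofracMn => /eqP; rewrite tofrac_eq0 => /eqP P2.
apply/polyP => l; have := congr1 (fun r : {poly int} => r`_l) P2.
by rewrite coefMn coef0 => /eqP; rewrite mulrn_eq0 => /eqP.
Qed.

Lemma horner_map_fun (A B : nzRingType) (f : A -> B) (p : {poly A}) (x : B) :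
  (map_poly f p).[x] = \sum_(k < size p) f p`_k * x ^+ k.
Proof. exact: horner_poly. Qed.

Lemma laurent_eval_opp (C : fieldType) (P : {poly {poly int}}) (i j : nat)
    (q0 t0 : C) : t_parity P j ->
  laurent_eval (P, i, j) q0 (- t0) = laurent_eval (P, i, j) q0 t0.
Proof.
move=> par; rewrite /laurent_eval !horner_map_fun !mulr_suml.
apply: eq_bigr => k _.
have [e|/par ->] := eqVneq (odd k) (odd j); last first.
  by rewrite map_poly0 horner0 !mul0r.
rewrite (exprNn t0 k) (exprNn t0 j) -[(-1) ^+ k]signr_odd e signr_odd.
rewrite invfM invr_sign.
have s2 : (-1) ^+ j * (-1) ^+ j = 1 :> C by rewrite -expr2 sqrr_sign.
move: ((-1) ^+ j) _.[q0] (t0 ^+ k) (q0 ^+ i)^-1 (t0 ^+ j)^-1 s2 => c a b u v s2.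
by rewrite -[RHS]mul1r -s2; ring.
Qed.

Lemma P_row_opp (C : fieldType) (N : nat) (w : seq piece) (q0 t0 : C) :
  knot_diagram w ->
  laurent_eval (P_row N w) q0 (- t0) = laurent_eval (P_row N w) q0 t0.
Proof.
(* Either no Laurent polynomial represents the quotient and [xget] returns zero, or the chosen one
   does. *)
move=> kw; have [->|] : P_row N w = (0, 0%N, 0%N) \/
    laurent_frac (P_row N w) = W_row N w / S_row N.
- by rewrite /P_row; case: xgetP => [L -> /=|_]; [right|left].
- by apply: laurent_eval_opp => k _; rewrite coef0.
case: (P_row N w) => [[P i] j] e.
apply/laurent_eval_opp/(@laurent_frac_parity _ i).
by rewrite e neg_t_W_div_S.
Qed.

(** * Evaluation at roots of unity *)

Section Cis.
Variable R : realType.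

Definition cis (x : R) : R[i] := cos x +i* sin x.

Lemma cisD (x y : R) : cis (x + y) = cis x * cis y.
Proof. by rewrite /cis cosD sinD; simpc; congr (_ +i* _); ring. Qed.

Lemma cis0 : cis 0 = 1.
Proof. by rewrite /cis cos0 sin0. Qed.

Lemma cispi : cis pi = -1.
Proof.
by rewrite /cis cospi sinpi; apply/eqP; rewrite eq_complex /= oppr0 !eqxx.
Qed.

Lemma cis_neq0 (x : R) : cis x != 0.
Proof.
have e : cis (- x) * cis x = 1 by rewrite -cisD addNr cis0.
by apply: contra_eq_neq e => ->; rewrite mulr0 eq_sym oner_eq0.
Qed.

Lemma cisN (x : R) : cis (- x) = (cis x)^-1.
Proof.
by apply: (mulIf (cis_neq0 x)); rewrite mulVf ?cis_neq0 // -cisD addNr cis0.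
Qed.

Lemma cisXn (x : R) (n : nat) : cis x ^+ n = cis (x *+ n).
Proof. by elim: n => [|n IH]; rewrite ?cis0 // exprS IH -cisD mulrS. Qed.

Lemma cisXz (x : R) (z : int) : cis x ^ z = cis (x *~ z).
Proof.
case: z => n; first by rewrite -exprnP cisXn.
by rewrite NegzE -exprnN cisXn -cisN mulrNz.
Qed.

Lemma xiE (s a : int) (N : nat) :
  xi R s a N = cis (s%:~R * pi / (N%:Z + a)%:~R).
Proof.
rewrite /xi -complexiE; set x := _ / _.
have -> : x%:C * 'i%C = 0 +i* x by simpc.
by rewrite /= expR0 mul1r.
Qed.

(** The value is [(-1)^s] by Euler's formula. When [N + a = 0] the argument divides by zero, but the
    exponent is then zero and the power is 1. *)
Lemma xiX (s a : int) (N : nat) :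
  xi R s a N ^ (N%:Z + a) = 1 \/ xi R s a N ^ (N%:Z + a) = -1.
Proof.
have [->|Na] := eqVneq (N%:Z + a) 0; first by left.
have -> : xi R s a N ^ (N%:Z + a) = (-1) ^ s.
  rewrite xiE cisXz -mulrzr divfK ?intr_eq0 //.
  by rewrite mulrC mulrzr -cisXz cispi.
case: (s) => n; rewrite ?NegzE -?exprnP -?exprnN -signr_odd;
  by case: (odd _); [right|left]; rewrite ?expr1 ?expr0 ?invrN ?invr1.
Qed.
End Cis.

(** The two values of [t] differ by the factor [q^(N+a)], which is 1 or -1, and evenness in [t]
    absorbs the sign. *)
Lemma J_SU_shift (R : realType) (n N : nat) (s a : int) (K : seq piece) :
  knot_diagram K ->
  J_SU (N%:Z + a + n%:Z) N K (xi R s a N) = J_SU n%:Z N K (xi R s a N).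
Proof.
move=> kK; rewrite /J_SU expfzDr; last by rewrite xiE cis_neq0.
by have [->|->] := xiX R s a N; rewrite ?mul1r // mulN1r P_row_opp.
Qed.

(* CS assigns to a knot complement the set of real numbers representing its
   Chern-Simons invariant (a set, because of the indeterminacy), for an
   arbitrary normalization. Log K a s N is the branch of the logarithm used, for
   the knot K and the parameters a and s, at the N-th term of the sequence. Both
   conventions are arbitrary, and shared by the two assertions. *)
Theorem theorem1p7 (R : realType)
  (CS : set (S3 R) -> set R)
  (Log : seq piece -> int -> int -> nat -> R[i] -> R[i])
  (hLog : forall K a s N, log_branch (Log K a s N))
  (n : nat) (hn : (2 <= n)%N) (s : int) :
  ((forall a : int, ~ (1 <= a <= n%:Z - 1) ->
      forall K : seq piece, knot_diagram K ->
      exists l : R[i],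
        log_growth (Log K a s) (fun N => J_SU n%:Z N K (xi R s a N)) l /\
        (2 * pi * s%:~R)%:C * l = 0)
   /\
   (forall a : int, 1 <= a <= n%:Z - 1 ->
      forall K : seq piece, knot_diagram K -> hyperbolic_link R K ->
      exists l : R[i],
        log_growth (Log K a s) (fun N => J_SU n%:Z N K (xi R s a N)) l /\
        exists2 c : R, CS (link_complement K) c &
          (2 * pi * s%:~R)%:C * l = Vol (link_complement K) +i* c))
  <->
  ((forall a : int, ~ (1 <= a <= n%:Z - 1) ->
      forall K : seq piece, knot_diagram K ->
      exists l : R[i],
        log_growth (Log K a s)
          (fun N => J_SU (N%:Z + a + n%:Z) N K (xi R s a N)) l /\
        (2 * pi * s%:~R)%:C * l = 0)
   /\
   (forall a : int, 1 <= a <= n%:Z - 1 ->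
      forall K : seq piece, knot_diagram K -> hyperbolic_link R K ->
      exists l : R[i],
        log_growth (Log K a s)
          (fun N => J_SU (N%:Z + a + n%:Z) N K (xi R s a N)) l /\
        exists2 c : R, CS (link_complement K) c &
          (2 * pi * s%:~R)%:C * l = Vol (link_complement K) +i* c)).
Proof.
(* The two sequences agree term by term, so with the same branches of the logarithm their growth
   conditions are the same proposition. *)
have shift_growth K a l : knot_diagram K ->
    log_growth (Log K a s)
      (fun N => J_SU (N%:Z + a + n%:Z) N K (xi R s a N)) l =
    log_growth (Log K a s) (fun N => J_SU n%:Z N K (xi R s a N)) l.
  by move=> kK; congr log_growth; apply/funext => N; rewrite J_SU_shift.
split=> -[A1 A2]; split.
- move=> a ha K kK; have [l [gl el]] := A1 a ha K kK.
  by exists l; rewrite shift_growth.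
- move=> a ha K kK hK; have [l [gl el]] := A2 a ha K kK hK.
  by exists l; rewrite shift_growth.
- move=> a ha K kK; have [l [gl el]] := A1 a ha K kK.
  by exists l; rewrite -shift_growth.
- move=> a ha K kK hK; have [l [gl el]] := A2 a ha K kK hK.
  by exists l; rewrite -shift_growth.
Qed.
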